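(* The Kleene/Kreisel total continuous functionals $\mathcal{C}^\omega$ are a model of $\mathsf{sBR}$: for all finite types $X,R$ there is a functional $\mathsf{sBR}_{X,R}$ in $\mathcal{C}^\omega$ such that for all $\phi\colon X^\dagger\to(X\to R)\to R$, $b\colon X^\dagger\to R$, $\varphi\colon X^{\mathbb{N}}\to\mathbb{N}$ and $u\colon X^\dagger$ in $\mathcal{C}^\omega$, $$\mathsf{sBR}^{\phi,b,\varphi}(u)=\begin{cases}b(u)&\text{if }\hat\varphi(u)\in\mathrm{dom}(u),\\ \phi(u)\big(\lambda x^X.\,\mathsf{sBR}^{\phi,b,\varphi}(u\oplus(\hat\varphi(u),x))\big)&\text{otherwise.}\end{cases}$$
   Context: $X^{\mathbb{N}}$ is the type $\mathbb{N}\to X$; $X^\dagger$ is the type of finite partial functions from $\mathbb{N}$ to $X$ with decidable finite domain $\mathrm{dom}(u)$ (encoded in the usual finite types, e.g. as finite sequences of pairs). $\mathbf{0}_X$ is the canonical element of type $X$; $\hat u\colon X^{\mathbb{N}}$ agrees with $u$ on $\mathrm{dom}(u)$ and is $\mathbf{0}_X$ elsewhere; $\hat\varphi(u):=\varphi(\hat u)$. $u\oplus(n,x)$ equals $u$ if $n\in\mathrm{dom}(u)$ and otherwise is $u$ extended with value $x$ at $n$. *)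

(* Defs.v *)
From mathcomp Require Import all_boot.
From mathcomp Require Import boolp.

Set Implicit Arguments.
Unset Strict Implicit.
Unset Printing Implicit Defensive.

(* The hierarchy C^omega is built in Kleene's way.  A space is a set of points
   together with a relation [names alpha x]: alpha : N -> N is an associate of
   the point x.  The points of a function space are those set-theoretic
   functions that possess an associate. *)
Record space := Space {
  point : Type;
  names : (nat -> nat) -> point -> Prop
}.

(* [kapp alpha beta gamma] says that gamma = alpha | beta is defined (Kleene's
   application of associates): gamma n is one less than the first nonzero
   value among alpha <n>, alpha <n, beta 0>, alpha <n, beta 0, beta 1>, ...,
   where <...> is the coding [pickle] of finite sequences by numbers. *)
Definition kapp (alpha beta gamma : nat -> nat) : Prop :=
  forall n, exists m,
    alpha (pickle (n :: mkseq beta m)) = (gamma n).+1 /\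
    forall m', m' < m -> alpha (pickle (n :: mkseq beta m')) = 0.

Definition tracks (A B : space) (alpha : nat -> nat)
    (f : point A -> point B) : Prop :=
  forall beta x, names beta x -> exists2 gamma, kapp alpha beta gamma &
    names gamma (f x).

Definition continuous (A B : space) (f : point A -> point B) : Prop :=
  exists alpha, tracks alpha f.

Record cfun (A B : space) := CFun {
  cfun_fun : point A -> point B;
  cfun_cont : continuous cfun_fun
}.

Definition arrow_space (A B : space) : space :=
  @Space (cfun A B) (fun alpha f => tracks alpha (cfun_fun f)).

Definition nat_space : space := @Space nat (fun alpha n => alpha 0 = n).

Definition bool_space : space := @Space bool (fun alpha b => alpha 0 = b).

Definition prod_space (A B : space) : space :=
  @Space (point A * point B) (fun alpha p =>
    names (fun j => alpha j.*2) p.1 /\ names (fun j => alpha j.*2.+1) p.2).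

Definition column (alpha : nat -> nat) (i j : nat) : nat :=
  alpha (pickle (i, j)).+1.

Definition seq_space (A : space) : space :=
  @Space (seq (point A)) (fun alpha s =>
    alpha 0 = size s /\
    forall i x, onth s i = Some x -> names (column alpha i) x).

Record pfun (A : Type) := PFun {
  pfun_fun : nat -> option A;
  pfun_fin : exists N, forall n, N <= n -> pfun_fun n = None
}.

Fixpoint assoc_lookup (A : Type) (s : seq (nat * A)) (n : nat) : option A :=
  if s is (k, x) :: s' then
    if k == n then Some x else assoc_lookup s' n
  else None.

(* A finite partial function is encoded by the finite sequences of pairs
   having it as their lookup function, so this is the finite type (N x A)^*
   modulo inducing the same partial function. *)
Definition pfun_space (A : space) : space :=
  @Space (pfun (point A)) (fun alpha u =>
    exists2 s : seq (nat * point A),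
      @names (seq_space (prod_space nat_space A)) alpha s &
      pfun_fun u =1 assoc_lookup s).

Inductive ftype :=
  | tnat
  | tbool
  | tprod of ftype & ftype
  | tseq of ftype
  | tpfun of ftype
  | tarr of ftype & ftype.

Declare Scope ftype_scope.
Delimit Scope ftype_scope with T.
Bind Scope ftype_scope with ftype.
Notation "X ^†" := (tpfun X) (at level 2, format "X ^†") : ftype_scope.
Notation "X ⇒ Y" := (tarr X Y)
  (at level 60, right associativity) : ftype_scope.

Fixpoint Comega (X : ftype) : space :=
  match X with
  | tnat => nat_space
  | tbool => bool_space
  | tprod X Y => prod_space (Comega X) (Comega Y)
  | tseq X => seq_space (Comega X)
  | tpfun X => pfun_space (Comega X)
  | tarr X Y => arrow_space (Comega X) (Comega Y)
  end.

Definition C (X : ftype) : Type := point (Comega X).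
Arguments C X%_T.

Definition ap (X Y : ftype) (f : C (X ⇒ Y)) : C X -> C Y := cfun_fun f.
#[warning="-uniform-inheritance"] Coercion ap : C >-> Funclass.

Notation cont X Y f := (@continuous (Comega X%T) (Comega Y%T) f).

(* [lam f h] is the functional [fun x => f x] of C^omega, where h shows that
   it has an associate. *)
Definition lam (X Y : ftype) (f : C X -> C Y) (h : cont X Y f) : C (X ⇒ Y) :=
  CFun h.
Arguments lam {X Y} f h.

Lemma pfun_ext (A : Type) (u v : pfun A) : pfun_fun u =1 pfun_fun v -> u = v.
Proof.
case: u v => [u hu] [v hv] /= /funext e; case: _ / e hv => hv.
by congr PFun; exact: Prop_irrelevance.
Qed.

Lemma pfun_assoc (A : Type) (u : pfun A) :
  exists s : seq (nat * A), pfun_fun u =1 assoc_lookup s.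
Proof.
case: u => u [N] /=; elim: N u => [|N IH] u hu.
  by exists [::] => n; rewrite hu.
pose v n := if n == N then None else u n.
have [n le_Nn|s hs] := IH v.
  rewrite /v; case: eqP => // /eqP neq; apply: hu.
  by rewrite ltn_neqAle eq_sym neq.
case E: (u N) => [x|].
  exists ((N, x) :: s) => n /=; rewrite -hs /v [N == n]eq_sym.
  by case: eqP => [->|].
by exists s => n; rewrite -hs /v; case: eqP => [->|].
Qed.

Lemma seq_column (f : nat -> nat -> nat) k :
  exists2 alpha, alpha 0 = k & forall i j, column alpha i j = f i j.
Proof.
exists (fun j => if j is j'.+1 then
  if (unpickle j' : option (nat * nat)) is Some p then f p.1 p.2 else 0
  else k) => //.
by move=> i j; rewrite /column pickleK.
Qed.

Lemma onth_choice (A : Type) (P : (nat -> nat) -> A -> Prop) (s : seq A) :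
  (forall x, exists alpha, P alpha x) ->
  exists f : nat -> nat -> nat, forall i x, onth s i = Some x -> P (f i) x.
Proof.
move=> h; have [|f hf] := @choice nat (nat -> nat)
    (fun i g => forall x, onth s i = Some x -> P g x); last by exists f.
move=> i; case: (onth s i) => [x|]; last by exists (fun=> 0).
by have [g hg] := h x; exists g => y [<-].
Qed.

Lemma names_seq (A : space) :
  (forall x : point A, exists alpha, names alpha x) ->
  forall s : point (seq_space A), exists alpha, names alpha s.
Proof.
move=> h s; have [f hf] := onth_choice s h.
have [alpha a0 ac] := seq_column f (size s).
exists alpha; split=> // i x hx.
by rewrite (_ : column alpha i = f i); [exact: hf | apply: funext].
Qed.

Lemma names_prod (A B : space) :
  (forall x : point A, exists alpha, names alpha x) ->
  (forall x : point B, exists alpha, names alpha x) ->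
  forall p : point (prod_space A B), exists alpha, names alpha p.
Proof.
move=> hA hB [x y]; have [a ha] := hA x; have [b hb] := hB y.
exists (fun j => if odd j then b j./2 else a j./2); split=> /=.
  rewrite (_ : (fun j => _) = a) //; apply: funext => j.
  by rewrite odd_double doubleK.
rewrite (_ : (fun j => _) = b) //; apply: funext => j /=.
by rewrite odd_double /= uphalf_double.
Qed.

Lemma names_ex (X : ftype) (x : C X) : exists alpha, names alpha x.
Proof.
rewrite /C in x *; elim: X x => [n|b|X IHX Y IHY|X IHX|X IHX|X IHX Y IHY [f hf]] /=.
- by exists (fun=> n).
- by exists (fun=> nat_of_bool b).
- exact: names_prod.
- exact: names_seq.
- move=> u; have [s hs] := pfun_assoc u.
  have [|alpha ha] := @names_seq (prod_space nat_space (Comega X)) _ s.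
    by apply: names_prod => // n; exists (fun=> n).
  by exists alpha; exists s.
- by have [alpha ha] := hf; exists alpha.
Qed.

(* An associate exists as soon as the values of the result are computed from
   finite initial segments of associates of the argument. *)
Lemma cont_approx (A B : space) (f : point A -> point B)
    (F : seq nat -> nat -> option nat) :
  (forall beta x, names beta x -> exists2 gamma, names gamma (f x) &
     forall n, (exists m, F (mkseq beta m) n = Some (gamma n)) /\
       forall m y, F (mkseq beta m) n = Some y -> y = gamma n) ->
  continuous f.
Proof.
move=> hF.
exists (fun c => if (unpickle c : option (seq nat)) is Some (n :: s) then
  if F s n is Some y then y.+1 else 0 else 0).
move=> beta x /hF[gamma hg hn]; exists gamma => // n.
have [[m0 hm0] huniq] := hn n.
have ex : exists m, isSome (F (mkseq beta m) n) by exists m0; rewrite hm0.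
case: (ex_minnP ex) => m; case E: (F _ n) => [y|] // _ hmin.
exists m; rewrite pickleK E (huniq _ _ E); split=> // m' lt_m'm.
rewrite pickleK; case E': (F _ n) => [y'|] //.
by move: (hmin m'); rewrite E' => /(_ isT); rewrite leqNgt lt_m'm.
Qed.

Lemma cont_query (A B : space) (f : point A -> point B)
    (h : nat -> nat) (g : nat -> nat -> nat) :
  (forall beta x, names beta x -> names (fun j => g j (beta (h j))) (f x)) ->
  continuous f.
Proof.
move=> hf; pose F s j := if h j < size s then Some (g j (nth 0 s (h j))) else None.
apply: (@cont_approx _ _ _ F) => beta x hx.
exists (fun j => g j (beta (h j))); first exact: hf.
move=> n; rewrite /F; split.
  by exists (h n).+1; rewrite size_mkseq ltnSn nth_mkseq.
by move=> m y; rewrite size_mkseq; case: ifP => // lt_m [<-]; rewrite nth_mkseq.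
Qed.

Lemma cont_const (X Y : ftype) (y : C Y) : cont X Y (fun=> y).
Proof.
have [a ha] := names_ex y.
exact: (@cont_query _ _ _ id (fun j _ => a j)).
Qed.

Lemma cont_nat (X : ftype) (f : nat -> C X) : cont tnat X f.
Proof.
have [a ha] := choice (fun n => names_ex (f n)).
by apply: (@cont_query _ _ _ (fun=> 0) (fun j b => a b j)) => beta n /= <-.
Qed.

Lemma take_mkseq (f : nat -> nat) k m : take k (mkseq f m) = mkseq f (minn k m).
Proof. by rewrite /mkseq -map_take take_iota. Qed.

Lemma cont_comp (X Y Z : ftype) (g : C (Y ⇒ Z)) (f : C X -> C Y) :
  cont X Y f -> cont X Z (fun x => g (f x)).
Proof.
move=> [a ha]; have [b hb] := cfun_cont g.
pose search (c : nat -> nat) (s : seq nat) n :=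
  let vs := [seq c (pickle (n :: take k s)) | k <- iota 0 (size s).+1] in
  ohead [seq v.-1 | v <- vs & 0 < v].
pose prefix s := fix prefix k := if k is k'.+1 then
    let t := prefix k' in
    if size t == k' then
      if search a s k' is Some y then rcons t y else t
    else t
  else [::].
(* the search finds the value of an application, once s is long enough *)
have searchP c beta gamma n : kapp c beta gamma ->
    exists m0, forall m, search c (mkseq beta m) n =
      if m0 <= m then Some (gamma n) else None.
  move=> /(_ n)[m0 [hm0 lt0]]; exists m0 => m; rewrite /search size_mkseq.
  have hv k : k <= m -> take k (mkseq beta m) = mkseq beta k.
    by move=> le_km; rewrite take_mkseq (minn_idPl le_km).
  case: leqP => le_m.
    rewrite -(subnKC le_m) -addnS iotaD add0n map_cat filter_cat map_cat.
    rewrite (_ : [seq v <- _ | _] = [::]) /=.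
      by rewrite subnKC // hv // hm0.
    apply/eqP; rewrite -[_ == _]negbK -has_filter; apply/hasPn => v.
    move=> /mapP[k]; rewrite mem_iota add0n => /= lt_k ->.
    by rewrite subnKC // hv ?lt0 // (leq_trans (ltnW lt_k)).
  rewrite (_ : [seq v <- _ | _] = [::]) //.
  apply/eqP; rewrite -[_ == _]negbK -has_filter; apply/hasPn => v.
  move=> /mapP[k]; rewrite mem_iota add0n => /= lt_k ->.
  by rewrite hv ?lt0 // (leq_trans lt_k).
apply: (@cont_approx _ _ _ (fun s n => search b (prefix s (size s)) n)).
move=> beta x /ha[gamma hag /hb[delta hbd hd]]; exists delta => // n.
have pre m k : exists2 l, l <= k & prefix (mkseq beta m) k = mkseq gamma l.
  elim: k => [|k [l le_lk IH]]; first by exists 0.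
  rewrite /= IH size_mkseq; case: eqP => [->|_]; last by exists l => //; exact: leqW.
  have [m0 ->] := searchP _ _ _ k hag.
  case: ifP => _; last by exists k.
  by exists k.+1 => //; rewrite mkseqS.
have [m1 hm1] := searchP _ _ _ n hbd; split; last first.
  move=> m y; have [l _ ->] := pre m (size (mkseq beta m)).
  by rewrite hm1; case: ifP => // _ [].
have [M hM] : exists M, forall m, M <= m -> forall k, k < m1 ->
    search a (mkseq beta m) k = Some (gamma k).
  elim: m1 {hm1} => [|m1 [M hM]]; first by exists 0.
  have [m0 hm0] := searchP _ _ _ m1 hag.
  exists (maxn M m0) => m; rewrite geq_max => /andP[le1 le2] k.
  rewrite ltnS leq_eqVlt => /orP[/eqP ->|]; last exact: hM.
  by rewrite hm0 le2.
pose m := maxn M m1; exists m; rewrite size_mkseq.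
have hk k : k <= m1 -> prefix (mkseq beta m) k = mkseq gamma k.
  elim: k => // k IH lt_k /=; rewrite IH ?(ltnW lt_k) // size_mkseq eqxx.
  by rewrite hM ?leq_maxl // mkseqS.
have hl k : m1 <= k -> exists2 l, m1 <= l & prefix (mkseq beta m) k = mkseq gamma l.
  elim: k => [|k IH]; first by rewrite leqn0 => /eqP e; exists 0; rewrite ?e.
  rewrite leq_eqVlt => /orP[/eqP e|]; first by exists m1 => //; rewrite -e hk.
  move=> /IH[l le_l /= ->]; rewrite size_mkseq; case: eqP => [<-|_]; last by exists l.
  have [m0 ->] := searchP _ _ _ l hag.
  case: ifP => _; last by exists l.
  by exists l.+1; [exact: leqW | rewrite mkseqS].
have [l le_l ->] := hl m (leq_maxr _ _).
by rewrite hm1 le_l.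
Qed.

Lemma pfun_empty_fin (A : Type) :
  exists N, forall n, N <= n -> (fun=> None : option A) n = None.
Proof. by exists 0. Qed.

(* the canonical element 0_X *)
Fixpoint zero (X : ftype) : C X :=
  match X return C X with
  | tnat => 0
  | tbool => false
  | tprod X Y => (zero X, zero Y)
  | tseq X => [::]
  | tpfun X => PFun (pfun_empty_fin (point (Comega X)))
  | tarr X Y => lam (fun=> zero Y) (@cont_const X Y (zero Y))
  end.

Section FinitePartialFunctions.
Variable X : ftype.
Implicit Types (u : C (X^†)) (n : C tnat) (x : C X).

Definition lookup u : nat -> option (C X) := pfun_fun u.

Definition dom u : pred nat := fun n => isSome (lookup u n).

Definition hat u : C (tnat ⇒ X) :=
  lam (fun n => odflt (zero X) (lookup u n)) (cont_nat _).

Definition oplus_fun u n x : nat -> option (C X) :=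
  fun k => if (k == n) && ~~ dom u n then Some x else lookup u k.

Lemma oplus_fin u n x :
  exists N, forall k, N <= k -> oplus_fun u n x k = None.
Proof.
have [N hN] := pfun_fin u; exists (maxn N n.+1) => k.
rewrite geq_max => /andP[le_Nk lt_nk].
by rewrite /oplus_fun (gtn_eqF lt_nk) /=; exact: hN.
Qed.

Definition oplus u n x : C (X^†) := PFun (oplus_fin u n x).

Lemma oplus_dom u n x : n \in dom u -> oplus u n x = u.
Proof.
by move=> hn; apply: pfun_ext => k /=; rewrite /oplus_fun -topredE /= in hn *;
   rewrite hn andbF.
Qed.

Lemma cont_oplus u n : cont X (X^†) (oplus u n).
Proof.
have [a [s [hs0 hsc] hs]] := names_ex u.
case: (boolP (n \in dom u)) => hn.
  have -> : oplus u n = fun=> u by apply: funext => x; exact: oplus_dom.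
  exact: cont_const.
pose h c := if c is c'.+1 then
    if (unpickle c' : option (nat * nat)) is Some (0, j) then j./2 else 0
  else 0.
pose g c v := if c is c'.+1 then
    if (unpickle c' : option (nat * nat)) is Some (i, j) then
      if i is i'.+1 then column a i' j else if odd j then v else n
    else 0
  else (a 0).+1.
apply: (@cont_query _ _ _ h g) => beta x hx.
exists ((n, x) :: s); last first.
  move=> k /=; rewrite /oplus_fun [k == n]eq_sym hn andbT.
  by case: eqP => // _; exact: hs.
split=> [/=|[|i] [k y]]; first by rewrite hs0.
  case=> <- <-; split; rewrite /= /column /g /h.
    by rewrite pickleK.
  rewrite (_ : (fun j => _) = beta) //.
  by apply: funext => j; rewrite pickleK /= odd_double /= uphalf_double.
move=> /hsc hi; rewrite (_ : column _ _ = column a i) //.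
by apply: funext => j; rewrite {1}/column /g pickleK.
Qed.

Lemma cont_ap_oplus (R : ftype) (f : C (X^† ⇒ R)) u n :
  cont X R (fun x => f (oplus u n x)).
Proof. exact: cont_comp (cont_oplus u n). Qed.

End FinitePartialFunctions.

Arguments cont_ap_oplus {X R} f u n.

(* Main.v *)
(** The realizer of a functional is built by a recursion guarded by finite
prefixes of associates, and then shown correct by bar induction.  A function
between two spaces has an associate iff it is tracked by an operation on Baire
space that is continuous at every name.  This makes closure under composition,
pairing and currying easy.  To realize [f y = step (fun x => f (d (y, x)), y)]
one only needs an associate of [fun x => f (d (y, x))]; its entry at [n :: s] is
allowed to consult approximations of [f] at stage [size s] only.  So the entries
are defined by recursion on [size s], whatever the name at hand is, and induction
along the well-founded relation from [y] to [d (y, x)] shows that on genuine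
names they do describe a total function.  For symmetric bar recursion the
relation is well founded: along an infinite branch [u i] the functions
[hat (u i)] converge to some [f], hence by continuity [vphi (hat (u i))] is
eventually constant; but it enters [dom (u i.+1)]. *)

Require Import Defs.
From mathcomp Require Import all_boot.
From mathcomp Require Import boolp.

Set Implicit Arguments.
Unset Strict Implicit.
Unset Printing Implicit Defensive.

(** * Operations on Baire space and their associates *)

Notation baire := (nat -> nat).

(* Junk value: when [Q] is empty and [T] is not, this is [Some] arbitrary value. *)
Definition common (I T : Type) (Q : I -> Prop) (v : I -> T) : option T :=
  if pselect (exists y, forall i, Q i -> v i = y) is left h
  then Some (projT1 (cid h)) else None.

Lemma common_val (I T : Type) (Q : I -> Prop) (v : I -> T) y i :
  common Q v = Some y -> Q i -> v i = y.
Proof. by rewrite /common; case: pselect => // h [<-]; case: cid => z /= hz /hz. Qed.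

Lemma common_eq (I T : Type) (Q : I -> Prop) (v : I -> T) y i :
  Q i -> (forall j, Q j -> v j = y) -> common Q v = Some y.
Proof.
move=> Qi h; rewrite /common; case: pselect => [h'|[]]; last by exists y.
by case: cid => z /= hz; rewrite -(hz i Qi) h.
Qed.

Lemma eq_common (I T : Type) (Q Q' : I -> Prop) (v v' : I -> T) :
  (forall i, Q i <-> Q' i) -> v =1 v' -> common Q v = common Q' v'.
Proof.
move=> hQ /funext ->; congr common.
by apply: funext => i; apply: propext.
Qed.

Definition agree m (beta beta' : baire) := forall j, j < m -> beta' j = beta j.

Lemma agree_sym m beta beta' : agree m beta beta' -> agree m beta' beta.
Proof. by move=> h j /h. Qed.

Lemma agree_trans m b1 b2 b3 : agree m b1 b2 -> agree m b2 b3 -> agree m b1 b3.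
Proof. by move=> h1 h2 j lt_j; rewrite h2 ?h1. Qed.

Lemma agreeW m m' beta beta' : m <= m' -> agree m' beta beta' -> agree m beta beta'.
Proof. by move=> le_m h j lt_j; apply: h; exact: leq_trans le_m. Qed.

Lemma agree_iff m b b' c : agree m b b' -> agree m b c <-> agree m b' c.
Proof.
by move=> h; split; apply: agree_trans => //; exact: agree_sym.
Qed.

Lemma agree_mkseq m beta beta' : agree m beta beta' -> mkseq beta' m = mkseq beta m.
Proof.
by move=> h; apply/eq_in_map => j; rewrite mem_iota add0n => /andP[_]; exact: h.
Qed.

Lemma agree_nth m beta : agree m beta (nth 0 (mkseq beta m)).
Proof. by move=> j lt_j; rewrite nth_mkseq. Qed.

Definition locally_const (T : Type) (G : baire -> T) beta :=
  exists m, forall beta', agree m beta beta' -> G beta' = G beta.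

Lemma locally_const_const (T : Type) (y : T) beta : locally_const (fun=> y) beta.
Proof. by exists 0. Qed.

Lemma locally_const_proj i beta : locally_const (fun b => b i) beta.
Proof. by exists i.+1 => b; apply. Qed.

(** Near [beta] the value of [a] is frozen, so local constancy of the single operation [G (a beta)]
    is enough. *)
Lemma locally_const_bind (S T : Type) (a : baire -> S) (G : S -> baire -> T) beta :
  locally_const a beta -> locally_const (G (a beta)) beta ->
  locally_const (fun b => G (a b) b) beta.
Proof.
move=> [m1 h1] [m2 h2]; exists (maxn m1 m2) => b hb.
rewrite (h1 b) ?(h2 b) //; apply: agreeW hb; rewrite ?leq_maxl ?leq_maxr //.
Qed.

Lemma locally_const_comp (S T : Type) (h : S -> T) (a : baire -> S) beta :
  locally_const a beta -> locally_const (fun b => h (a b)) beta.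
Proof. by move=> [m hm]; exists m => b /hm ->. Qed.

Lemma locally_const_map (I T : Type) (h : I -> baire -> T) (s : seq I) beta :
  (forall i, locally_const (h i) beta) ->
  locally_const (fun b => [seq h i b | i <- s]) beta.
Proof.
move=> hl; elim: s => [|i s IH] /=; first exact: locally_const_const.
exact: (locally_const_bind (G := fun x b => x :: _) (hl i) (locally_const_comp _ IH)).
Qed.

Lemma locally_const_prefix (G : baire -> baire) beta :
  (forall n, locally_const (G ^~ n) beta) ->
  forall k, exists M, forall beta', agree M beta beta' -> agree k (G beta) (G beta').
Proof.
move=> h; elim=> [|k [M hM]]; first by exists 0.
have [m hm] := h k; exists (maxn M m) => b hb j.
rewrite ltnS leq_eqVlt => /orP[/eqP ->|].
  by apply: hm; apply: agreeW hb; exact: leq_maxr.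
by apply: hM; apply: agreeW hb; exact: leq_maxl.
Qed.

Definition lpart (beta : baire) : baire := fun j => beta j.*2.
Definition rpart (beta : baire) : baire := fun j => beta j.*2.+1.
Definition join (b1 b2 : baire) : baire :=
  fun j => if odd j then b2 j./2 else b1 j./2.

Lemma lpart_join b1 b2 : lpart (join b1 b2) = b1.
Proof. by apply: funext => j; rewrite /lpart /join odd_double doubleK. Qed.

Lemma rpart_join b1 b2 : rpart (join b1 b2) = b2.
Proof.
by apply: funext => j; rewrite /rpart /join /= odd_double /= uphalf_double.
Qed.

Lemma agree_join m b1 b2 b1' b2' :
  agree m b1 b1' -> agree m b2 b2' -> agree m (join b1 b2) (join b1' b2').
Proof.
move=> h1 h2 j lt_j; rewrite /join.
have lt : j./2 < m by apply: leq_ltn_trans lt_j; rewrite -divn2 leq_div.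
by case: odd; rewrite ?h1 ?h2.
Qed.

Lemma agree_lpart m b b' : agree m.*2 b b' -> agree m (lpart b) (lpart b').
Proof. by move=> h j lt_j; apply: h; rewrite ltn_double. Qed.

Lemma agree_rpart m b b' : agree m.*2 b b' -> agree m (rpart b) (rpart b').
Proof. by move=> h j lt_j; apply: h; rewrite ltn_Sdouble. Qed.

Lemma names_join (A B : space) b1 b2 (x : point A) (y : point B) :
  names b1 x -> names b2 y -> @names (prod_space A B) (join b1 b2) (x, y).
Proof. by rewrite -{1}(lpart_join b1 b2) -{2}(rpart_join b1 b2). Qed.

(* The associate reading off [F s n], where [s] is the prefix of the argument
   that is known. *)
Definition code (F : seq nat -> nat -> option nat) : baire := fun c =>
  if (unpickle c : option (seq nat)) is Some (n :: s) then
    if F s n is Some y then y.+1 else 0 else 0.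

Lemma code_kapp F beta gamma :
  (forall n, exists m, F (mkseq beta m) n = Some (gamma n)) ->
  (forall n m y, F (mkseq beta m) n = Some y -> y = gamma n) ->
  kapp (code F) beta gamma.
Proof.
move=> hex hu n; have [m0 hm0] := hex n.
have ex : exists m, isSome (F (mkseq beta m) n) by exists m0; rewrite hm0.
case: (ex_minnP ex) => m; case E: (F _ n) => [y|] // _ hmin.
exists m; rewrite /code pickleK E (hu _ _ _ E); split=> // m' lt_m'm.
rewrite pickleK; case E': (F _ n) => [y'|] //.
by move: (hmin m'); rewrite E' => /(_ isT); rewrite leqNgt lt_m'm.
Qed.

(** A code bounds the length of the list it encodes, and unpickling the entries can only drop some.
    Hence the entry of an associate at [c] sees fewer than [c] values of the argument, which grounds
    the recursion on stages. *)
Lemma size_unpickle c n s : (unpickle c : option (seq nat)) = Some (n :: s) ->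
  size s < c.
Proof.
have size_code t : size t <= CodeSeq.code t.
  elim: t => //= i t IH; apply: leq_trans (leq_pmull _ _); last by rewrite expn_gt0.
  by rewrite ltnS -addnn (leq_trans IH) ?leq_addl.
move=> [e]; have := size_code (CodeSeq.decode c); rewrite CodeSeq.decodeK.
apply: leq_trans; rewrite -[_.+1]/(size (n :: s)) -e size_pmap count_size //.
Qed.

Definition fires (alpha beta : baire) n m :=
  alpha (pickle (n :: mkseq beta m)) != 0 /\
  forall m', m' < m -> alpha (pickle (n :: mkseq beta m')) = 0.

(** At most one stage fires, so [common] yields its answer; if none fires, the value is junk. This
    turns the relation [kapp] into a total operation. *)
Definition kval (alpha beta : baire) : baire := fun n =>
  odflt 0 (common (fires alpha beta n)
    (fun m => (alpha (pickle (n :: mkseq beta m))).-1)).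

Lemma kapp_val alpha beta gamma n : kapp alpha beta gamma ->
  exists M, forall alpha' beta', agree M alpha alpha' -> agree M beta beta' ->
    kval alpha' beta' n = gamma n.
Proof.
move=> /(_ n)[m [hm lt0]].
(* [M] is at least the answering stage [m] and exceeds every code consulted up to it. *)
pose M := maxn m (\max_(i < m.+1) pickle (n :: mkseq beta i)).+1.
exists M => alpha' beta' ha hb.
have E i : i <= m -> alpha' (pickle (n :: mkseq beta' i)) =
    alpha (pickle (n :: mkseq beta i)).
  move=> le_im; rewrite (@agree_mkseq _ beta).
    apply: ha; rewrite leq_max ltnS; apply/orP; right.
    by rewrite (@leq_bigmax _ (fun i : 'I_m.+1 => pickle (n :: mkseq beta i))
         (Ordinal (n:=m.+1) (m:=i) _)).
  by apply: agreeW hb; rewrite (leq_trans le_im) ?leq_maxl.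
rewrite /kval (@common_eq _ _ _ _ (gamma n) m) //.
  split=> [|m' lt_m']; first by rewrite E ?hm.
  by rewrite E ?lt0 ?(ltnW lt_m').
move=> j [nz ltj]; case: (ltngtP j m) => [lt|lt|->]; last by rewrite E ?hm.
  by move: nz; rewrite E ?(ltnW lt) // lt0.
by move: (ltj m lt); rewrite E ?hm.
Qed.

(** * Continuity through realizers on Baire space *)

Definition realizer (A B : space) (f : point A -> point B) (G : baire -> baire) :=
  forall beta x, names beta x ->
    names (G beta) (f x) /\ forall n, locally_const (G ^~ n) beta.

Lemma continuousP (A B : space) (f : point A -> point B) :
  continuous f <-> exists G, realizer f G.
Proof.
split=> [[alpha ha]|[G hG]].
  exists (kval alpha) => beta x /ha[gamma hk hg].
  have hv n := kapp_val n hk.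
  have E n : kval alpha beta n = gamma n by have [M ->] := hv n.
  split=> [|n]; first by rewrite (funext E).
  by have [M hM] := hv n; exists M => b hb; rewrite E hM.
(* The associate answers as soon as all extensions of [s] give the same value; the argument is one
   of them, so no answer is wrong. *)
pose F s n := common (agree (size s) (nth 0 s)) (fun b => G b n).
apply: (@cont_approx _ _ _ F) => beta x /hG[hn hl].
exists (G beta) => // n; have [m hm] := hl n; split.
  exists m; apply: (@common_eq _ _ _ _ _ beta); rewrite size_mkseq.
    exact/agree_sym/agree_nth.
  by move=> b /(agree_trans (@agree_nth m beta)); exact: hm.
move=> k y E; rewrite -(common_val (i := beta) E) // size_mkseq.
exact/agree_sym/agree_nth.
Qed.

Lemma continuous_comp (A B D : space) (g : point B -> point D) (f : point A -> point B) :
  continuous g -> continuous f -> continuous (fun x => g (f x)).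
Proof.
move=> /continuousP[Gg hg] /continuousP[Gf hf]; apply/continuousP.
exists (fun b => Gg (Gf b)) => beta x /hf[nf lf].
have [ng lg] := hg _ _ nf; split=> // n; have [m hm] := lg n.
by have [M hM] := locally_const_prefix lf m; exists M => b /hM/hm.
Qed.

Lemma continuous_pair (A B D : space) (f : point A -> point B) (g : point A -> point D) :
  continuous f -> continuous g ->
  @continuous A (prod_space B D) (fun x => (f x, g x)).
Proof.
move=> /continuousP[Gf hf] /continuousP[Gg hg]; apply/continuousP.
exists (fun b => join (Gf b) (Gg b)) => beta x hx.
have [nf lf] := hf _ _ hx; have [ng lg] := hg _ _ hx.
by split=> [|n]; [exact: names_join|rewrite /join; case: odd].
Qed.

Lemma continuous_fst (A B : space) : @continuous (prod_space A B) A fst.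
Proof.
apply/continuousP; exists lpart => beta x [hx _].
by split=> // n; exact: locally_const_proj.
Qed.

Lemma continuous_snd (A B : space) : @continuous (prod_space A B) B snd.
Proof.
apply/continuousP; exists rpart => beta x [_ hx].
by split=> // n; exact: locally_const_proj.
Qed.

Lemma continuous_eval (A B : space) :
  @continuous (prod_space (arrow_space A B) A) B (fun p => cfun_fun p.1 p.2).
Proof.
apply/continuousP; exists (fun b => kval (lpart b) (rpart b)) => beta [f x] [hf hx].
have [gamma hk hg] := hf _ _ hx.
have E n : kval (lpart beta) (rpart beta) n = gamma n.
  by have [M ->] := kapp_val n hk.
split=> [|n]; first by rewrite (funext E).
have [M hM] := kapp_val n hk; exists M.*2 => b hb; rewrite E hM //.
  exact: agree_lpart.
exact: agree_rpart.
Qed.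

Lemma continuous_app (Z A B : space) (f : point Z -> cfun A B) (g : point Z -> point A) :
  @continuous Z (arrow_space A B) f -> continuous g ->
  continuous (fun z => cfun_fun (f z) (g z)).
Proof.
move=> hf hg; exact: continuous_comp (@continuous_eval A B) (continuous_pair hf hg).
Qed.

Lemma cfun_ext (A B : space) (f g : cfun A B) : cfun_fun f =1 cfun_fun g -> f = g.
Proof.
case: f g => [f hf] [g hg] /= /funext e; case: _ / e hg => hg.
by congr CFun; exact: Prop_irrelevance.
Qed.

Lemma cont_curry (A B D : ftype) (f : C (tprod A B) -> C D) :
  cont (tprod A B) D f ->
  exists2 F : C A -> C (B ⇒ D), cont A (B ⇒ D) F &
    forall a b, F a b = f (a, b).
Proof.
move=> /continuousP[G hG].
pose Q (beta : baire) s (p : baire * baire) :=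
  agree (size s) beta p.1 /\ agree (size s) (nth 0 s) p.2.
(* An entry with known part [s] consults only [size s] values of [beta], so [L] is itself locally
   constant in [beta]. *)
pose L beta := code (fun s n =>
  common (Q beta s) (fun p => G (join p.1 p.2) n)).
have hL beta a : names beta a ->
    @tracks (Comega B) (Comega D) (L beta) (fun b => f (a, b)).
  move=> ha delta b hb; have [hn hl] := hG _ (a, b) (names_join ha hb).
  exists (G (join beta delta)) => //.
  have Qm m : Q beta (mkseq delta m) (beta, delta).
    by rewrite /Q size_mkseq; split=> //; exact/agree_sym/agree_nth.
  apply: code_kapp => n; last by move=> m y E; rewrite -(common_val E (Qm m)).
  have [m hm] := hl n; exists m; apply: (common_eq (Qm m)) => -[b1 b2].
  rewrite /Q size_mkseq => -[/= h1 h2]; apply: hm; apply: agree_join => //.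
  exact: agree_trans (@agree_nth m delta) h2.
have hF a : cont B D (fun b => f (a, b)).
  by have [beta ha] := names_ex a; exists (L beta); exact: hL.
exists (fun a => lam _ (hF a)) => //; apply/continuousP.
exists L => beta a ha; split=> [|c]; first exact: hL.
rewrite /L /code; case: unpickle => [[|n s]|]; try exact: locally_const_const.
exists (size s) => b hb; rewrite (@eq_common _ _ (Q b s) (Q beta s) _ _ _ (frefl _)) //.
by move=> p; rewrite /Q; have := agree_iff p.1 hb; tauto.
Qed.

(** * Recursion along a well-founded relation *)

(** The table [tab k] is correct below [k] and filled with [t0] from there on; [op k] depends on the
    correct entries only. *)
Lemma strong_rec (T : Type) (t0 : T) (op : nat -> (nat -> T) -> T) :
  (forall k H H', (forall m, m < k -> H m = H' m) -> op k H = op k H') ->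
  exists H, forall k, H k = op k H.
Proof.
move=> hop; pose tab := fix tab k := if k is k'.+1 then
    fun m => if m == k' then op k' (tab k') else tab k' m
  else fun=> t0.
have tabE k m : m < k -> tab k m = tab m.+1 m.
  elim: k => // k IH; rewrite ltnS leq_eqVlt => /orP[/eqP ->//|lt_m].
  by rewrite /= (ltn_eqF lt_m) eqxx IH //= eqxx.
exists (fun m => tab m.+1 m) => k /=; rewrite eqxx; apply: hop => m lt_m.
by rewrite tabE //= eqxx.
Qed.

(* The approximation [H k beta n] of the [n]-th value of the realizer inspects
   [beta] and the associate [rec_assoc D H beta] of the recursive call only
   below [k].  An entry [n :: s] of the latter uses the approximations at stage
   [size s] alone: this makes the recursion on [k] well founded, and keeps
   [rec_assoc D H beta] independent of [k]. *)
Definition rec_assoc (D : baire -> baire) (H : nat -> baire -> nat -> option nat)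
    (beta : baire) : baire :=
  code (fun s n => obind id (common
    (fun p : baire * baire =>
       agree (size s) beta p.1 /\ agree (size s) (nth 0 s) p.2)
    (fun p => H (size s) (D (join p.1 p.2)) n))).

Definition rec_approx (S : baire -> baire) D k
    (H : nat -> baire -> nat -> option nat) (beta : baire) n : option nat :=
  common (fun p : baire * baire =>
            agree k (rec_assoc D H beta) p.1 /\ agree k beta p.2)
         (fun p => S (join p.1 p.2) n).

Lemma agree_rec_assoc D k (H H' : nat -> baire -> nat -> option nat) beta beta' :
  (forall m, m < k -> H m = H' m) -> agree k beta beta' ->
  agree k (rec_assoc D H beta) (rec_assoc D H' beta').
Proof.
move=> hH hb c lt_c; rewrite /rec_assoc /code.
case E: (unpickle c) => [[|n s]|] //.
have lt_s : size s < k by apply: ltn_trans lt_c; exact: size_unpickle E.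
rewrite hH //; congr (if obind id _ is Some _ then _ else _).
apply: eq_common => // p.
by have := agree_iff p.1 (agreeW (ltnW lt_s) hb); tauto.
Qed.

Lemma rec_approx_ext S D k H H' beta beta' :
  (forall m, m < k -> H m = H' m) -> agree k beta beta' ->
  rec_approx S D k H beta = rec_approx S D k H' beta'.
Proof.
move=> hH hb; apply: funext => n; apply: eq_common => // p.
have := agree_iff p.1 (agree_rec_assoc D hH hb).
by have := agree_iff p.2 hb; tauto.
Qed.

(** Raising [k] leaves fewer pairs that have to agree on a value, and the pair
    [(rec_assoc D H beta, beta)] always remains. *)
Lemma rec_approx_mono S D k k' H beta n y : k <= k' ->
  rec_approx S D k H beta n = Some y -> rec_approx S D k' H beta n = Some y.
Proof.
move=> le_k E; apply: (@common_eq _ _ _ _ _ (rec_assoc D H beta, beta)) => //.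
move=> p [h1 h2]; apply: common_val E _; split; exact: agreeW le_k _.
Qed.

(** The recursion as a graph: the values of the recursive calls must already form a functional with
    an associate, since [step] accepts nothing else. *)
Inductive rec_value (Y X R : space) (stop : point Y -> bool)
    (base : point Y -> point R) (step : cfun X R * point Y -> point R)
    (d : point Y * point X -> point Y) : point Y -> point R -> Prop :=
| RecStop y : stop y -> rec_value stop base step d y (base y)
| RecStep y (g : cfun X R) : ~~ stop y ->
    (forall x, rec_value stop base step d (d (y, x)) (cfun_fun g x)) ->
    rec_value stop base step d y (step (g, y)).

Lemma rec_value_uniq (Y X R : space) stop base step d y r r' :
  @rec_value Y X R stop base step d y r ->
  rec_value stop base step d y r' -> r = r'.
Proof.
move=> h; elim: h r' => {y r} [y hy|y g hy _ IH] r' h'.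
  by case: h' hy => // z g nz _ /(elimN idP nz).
case: h' hy IH => [z hz /negP[]//|z g' _ hg' _ IH].
by congr (step (_, _)); apply: cfun_ext => x; exact: IH.
Qed.

Lemma bar_recursion (Y X R : space) (stop : point Y -> bool)
    (base : point Y -> point R)
    (step : point (prod_space (arrow_space X R) Y) -> point R)
    (d : point (prod_space Y X) -> point Y) :
  (forall y : point Y, exists beta, names beta y) ->
  @continuous Y bool_space stop -> continuous base -> continuous step ->
  continuous d ->
  well_founded (fun y' y => ~~ stop y /\ exists x, y' = d (y, x)) ->
  exists2 f : point Y -> point R, continuous f &
    forall y (h : continuous (fun x => f (d (y, x)))),
      f y = if stop y then base y else step (CFun h, y).
Proof.
move=> hY /continuousP[St hSt] /continuousP[B hB] /continuousP[T hT].
move=> /continuousP[D hD] wf.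
(* The left half of [b] is to be an associate of the recursive calls, the right half a name of [y].
   The test reads the right half alone, and [true] is named by 1. *)
pose S b := if St (rpart b) 0 == 1 then B (rpart b) else T b.
have [H HE] : exists H, forall k, H k = rec_approx S D k H.
  apply: strong_rec; first by move=> _ _; exact: None.
  by move=> k H H' hH; apply: funext => b; exact: rec_approx_ext.
have Hmono k k' beta n y : k <= k' -> H k beta n = Some y -> H k' beta n = Some y.
  by rewrite !HE; exact: rec_approx_mono.
have Hagree k beta beta' : agree k beta beta' -> H k beta = H k beta'.
  by move=> hb; rewrite HE; exact: rec_approx_ext.
pose G := rec_assoc D H.
pose lim beta (gamma : baire) := forall n, exists k, H k beta n = Some (gamma n).
have limS beta : (forall n, locally_const (S ^~ n) (join (G beta) beta)) ->
    lim beta (S (join (G beta) beta)).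
  move=> hl n; have [k hk] := hl n; exists k.
  rewrite HE; apply: (@common_eq _ _ _ _ _ (G beta, beta)) => // p [h1 h2].
  exact/hk/agree_join.
pose good (y : point Y) (r : point R) := forall beta, names beta y ->
  exists2 gamma, lim beta gamma & names gamma r.
(* The value and its approximations share one induction: [step] can be applied only once convergence
   at all [d (y, x)] has produced an associate of the recursive calls. *)
have hex y : exists r, rec_value stop base step d y r /\ good y r.
  elim/(well_founded_ind wf): y => y IH.
  case hs: (stop y).
    exists (base y); split=> [|beta hb]; first exact: RecStop.
    have [nB lB] := hB _ _ hb; have [/= nSt lSt] := hSt _ _ hb.
    have [m hm] := lSt 0.
    have SE b : agree m.*2 (join (G beta) beta) b -> S b = B (rpart b).
      move=> /agree_rpart; rewrite rpart_join => /hm; rewrite nSt hs => e.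
      by rewrite /S e.
    exists (S (join (G beta) beta)); last by rewrite SE // rpart_join.
    apply: limS => n; have [k hk] := lB n; exists (maxn m k).*2 => b hb'.
    rewrite !SE //; last by apply: agreeW hb'; rewrite leq_double leq_maxl.
    rewrite rpart_join hk // -(rpart_join (G beta) beta).
    by apply/agree_rpart/agreeW/hb'; rewrite leq_double leq_maxr.
  have /choice[g hg] : forall x, exists r,
      rec_value stop base step d (d (y, x)) r /\ good (d (y, x)) r.
    by move=> x; apply: IH; split; [rewrite hs|exists x].
  have trG beta : names beta y -> @tracks X R (G beta) g.
    move=> hb delta x hx; have [nD lD] := hD _ (y, x) (names_join hb hx).
    have [_ /(_ _ nD)[gamma hl hn]] := hg x; exists gamma => //.
    have Qm m : agree m beta beta /\ agree m (nth 0 (mkseq delta m)) delta.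
      by split=> //; exact/agree_sym/agree_nth.
    apply: code_kapp => n; rewrite /=; last first.
      (* Any answer is a value of [H] at the name [D (join beta delta)] of [d (y, x)]; by
         monotonicity it agrees with the limit. *)
      move=> m z; rewrite size_mkseq; case E: common => [[z'|]|] //= [<-].
      have := common_val (i := (beta, delta)) E (Qm m) => /= {}E.
      have [k hk] := hl n; have := Hmono _ _ _ _ _ (leq_maxl m k) E.
      by rewrite (Hmono _ _ _ _ _ (leq_maxr m k) hk) => -[].
    (* Stage [k] settles the value, and [M] entries fix the first [k] entries of the result of [D];
       from both stages on all extensions agree. *)
    have [k hk] := hl n; have [M hM] := locally_const_prefix lD k.
    exists (maxn M k); rewrite size_mkseq.
    rewrite (@common_eq _ _ _ _ (Some (gamma n)) (beta, delta)) //.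
    move=> -[b1 b2] [/= h1 h2]; apply: (Hmono k); first exact: leq_maxr.
    rewrite -hk; congr (_ n); apply/esym/Hagree/hM/agree_join.
      by apply: agreeW h1; exact: leq_maxl.
    apply: agreeW (agree_trans (@agree_nth _ delta) h2); exact: leq_maxl.
  have cg : @continuous X R g by have [beta hb] := hY y; exists (G beta); exact: trG.
  exists (step (CFun cg, y)); split.
    by apply: RecStep => [|x]; [rewrite hs|exact: (hg x).1].
  move=> beta hb.
  have [nT lT] := hT _ (CFun cg, y)
    (@names_join (arrow_space X R) Y _ _ (CFun cg) y (trG _ hb) hb).
  have [/= nSt lSt] := hSt _ _ hb; have [m hm] := lSt 0.
  have SE b : agree m.*2 (join (G beta) beta) b -> S b = T b.
    by move=> /agree_rpart; rewrite rpart_join => /hm; rewrite nSt hs /S => ->.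
  exists (S (join (G beta) beta)); last by rewrite SE.
  apply: limS => n; have [k hk] := lT n; exists (maxn m.*2 k) => b hb'.
  rewrite !SE //; last by apply: agreeW hb'; exact: leq_maxl.
  by apply: hk; apply: agreeW hb'; exact: leq_maxr.
have [f hf] := choice hex; exists f => [|y h].
  (* One family [H] serves all points. Padding [s] with 0 is harmless, since stage [size s] looks no
     further than [s]. *)
  apply: (@cont_approx _ _ _ (fun s n => H (size s) (nth 0 s) n)) => beta y hb.
  have [_ /(_ _ hb)[gamma hl hn]] := hf y; exists gamma => // n.
  have E m : H m (nth 0 (mkseq beta m)) = H m beta.
    exact/esym/Hagree/agree_nth.
  have [k hk] := hl n; split=> [|m z]; first by exists k; rewrite size_mkseq E.
  rewrite size_mkseq E => /(Hmono _ _ _ _ _ (leq_maxl m k)).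
  by rewrite (Hmono _ _ _ _ _ (leq_maxr m k) hk) => -[].
apply: rec_value_uniq (hf y).1 _; case: ifP => hs; first exact: RecStop.
by apply: RecStep => [|x]; [rewrite hs|exact: (hf _).1].
Qed.

(** * Finite partial functions *)

(** The left half of a pair lies at even places and a number is named by its value at 0, so place 0
    of column [i] holds the [i]-th key. *)
Definition keys (beta : baire) := [seq column beta i 0 | i <- iota 0 (beta 0)].

Lemma locally_const_keys beta : locally_const keys beta.
Proof.
apply: (locally_const_bind (G := fun n b => [seq column b i 0 | i <- iota 0 n])).
  exact: locally_const_proj.
by apply: locally_const_map => i; exact: locally_const_proj.
Qed.

Lemma assoc_lookup_index (A : Type) (s : seq (nat * A)) n :
  assoc_lookup s n = omap snd (onth s (index n (unzip1 s))).
Proof. by elim: s => //= -[k x] s IH /=; case: eqP. Qed.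

Lemma keys_unzip1 (X : ftype) beta (s : seq (nat * C X)) :
  @names (seq_space (prod_space nat_space (Comega X))) beta s ->
  keys beta = unzip1 s.
Proof.
move=> [hs hi]; rewrite /keys hs; apply: eq_from_onth => i.
rewrite !onth_map; case: (ltnP i (size s)) => hi'; last first.
  by rewrite !onth_default ?size_iota.
move: (onthTE s i); rewrite hi'; case E: (onth s i) => [p|] // _.
rewrite onthE (nth_map 0) ?size_iota // nth_iota // add0n /=.
by congr Some; case: (hi _ _ E).
Qed.

(** Keys may repeat, but [index] finds the first occurrence, which is also the one that
    [assoc_lookup] uses. *)
Lemma names_pfun (X : ftype) beta (u : C (X^†)) n :
  @names (Comega (X^†)) beta u ->
  (dom u n = (n \in keys beta)) *
  (forall x, lookup u n = Some x ->
     names (fun j => column beta (index n (keys beta)) j.*2.+1) x).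
Proof.
move=> [s hs hu]; rewrite (keys_unzip1 hs) /dom /lookup hu assoc_lookup_index.
split=> [|x].
  rewrite -index_mem size_map -onthTE; by case: onth.
case E: onth => [[k y]|] //= [<-].
by case: hs => _ /(_ _ _ E)[].
Qed.

Lemma cont_dom (X : ftype) :
  cont (tprod (X^†) tnat) tbool (fun p => dom p.1 p.2).
Proof.
apply/continuousP; exists (fun b _ => rpart b 0 \in keys (lpart b)).
move=> beta [u n] [/= hu hn]; split=> [|j].
  by have [-> _] := names_pfun n hu; rewrite -hn.
apply: (locally_const_bind (G := fun k b => nat_of_bool (k \in keys (lpart b)))).
  exact: locally_const_proj.
apply: (locally_const_comp (fun t => nat_of_bool (_ \in t))).
have [m hm] := locally_const_keys (lpart beta); exists m.*2 => b hb.
exact/hm/agree_lpart.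
Qed.

Lemma cont_lookup (X : ftype) :
  cont (tprod (X^†) tnat) X (fun p => odflt (zero X) (lookup p.1 p.2)).
Proof.
have [z hz] := names_ex (zero X).
apply/continuousP; exists (fun b j =>
  if rpart b 0 \in keys (lpart b) then
    column (lpart b) (index (rpart b 0) (keys (lpart b))) j.*2.+1 else z j).
move=> beta [u n] [/= hu hn]; have [hd hl] := names_pfun n hu.
rewrite -[rpart beta 0]/(beta 1) in hn *; split=> [|j].
  move: hd; rewrite /dom hn; case E: lookup => [x|] <- //=; exact: hl.
have lk : locally_const (fun b => keys (lpart b)) beta.
  have [m hm] := locally_const_keys (lpart beta); exists m.*2 => b hb.
  exact/hm/agree_lpart.
(* First the key and then the list of keys is frozen; what is left is a projection or a constant. *)
apply: (locally_const_bind (G := fun k b => if k \in keys (lpart b) then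
   column (lpart b) (index k (keys (lpart b))) j.*2.+1 else z j)).
  exact: locally_const_proj.
apply: (locally_const_bind (G := fun t b => if rpart beta 0 \in t then
   column (lpart b) (index (rpart beta 0) t) j.*2.+1 else z j) lk).
case: (_ \in _); [exact: locally_const_proj|exact: locally_const_const].
Qed.

Lemma cont_hat (X : ftype) : cont (X^†) (tnat ⇒ X) (@hat X).
Proof.
have [F hF E] := cont_curry (cont_lookup X).
rewrite (_ : @hat X = F) //; apply: funext => u; apply: cfun_ext => n.
exact: (esym (E u n)).
Qed.

Lemma assoc_lookup_rcons (A : Type) (s : seq (nat * A)) n x k :
  assoc_lookup (rcons s (n, x)) k =
  if assoc_lookup s k is Some y then Some y else if n == k then Some x else None.
Proof. by elim: s => //= -[i y] s ->; case: eqP. Qed.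

(* Appending [(n, x)] at the end of an encoding of [u] leaves the values of [u]
   untouched, whether or not [n] is in the domain. *)
Lemma cont_oplus_joint (X : ftype) :
  cont (tprod (X^†) (tprod tnat X)) (X^†) (fun p => oplus p.1 p.2.1 p.2.2).
Proof.
(* Columns below the length [N] are copied in place; those from [N] on carry a name of the new
   pair. *)
pose entry (b : baire) N c i j :=
  if i < N then lpart b c
  else join (fun=> lpart (rpart b) 0) (rpart (rpart b)) j.
pose G (b : baire) c := if c is c'.+1 then
    if (unpickle c' : option (nat * nat)) is Some (i, j) then
      entry b (lpart b 0) c i j
    else 0
  else (lpart b 0).+1.
apply/continuousP; exists G => beta [u [n x]] [/= [s hs hu] [/= hn hx]].
split; last first.
  case=> [|c]; first exact: (locally_const_comp S (locally_const_proj 0 _)).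
  rewrite /G; case: unpickle => [[i j]|]; last exact: locally_const_const.
  apply: (locally_const_bind (G := fun N b => entry b N c.+1 i j) (locally_const_proj 0 _)).
  rewrite /entry; case: (_ < _); first exact: locally_const_proj.
  by rewrite /join; case: odd; exact: locally_const_proj.
case: hs => [h0 hc].
have GE i j : column (G beta) i j = entry beta (size s) (pickle (i, j)).+1 i j.
  by rewrite /column /G pickleK [lpart _ _]h0.
exists (rcons s (n, x)); last first.
  move=> k; rewrite assoc_lookup_rcons -hu /= /oplus_fun eq_sym /dom /lookup.
  by case: eqP => [<-|_] /=; case: pfun_fun.
split=> [|i p]; first by rewrite size_rcons /G [lpart _ _]h0.
rewrite -cats1 onth_cat; case: ltnP => hi hp.
  have [h1 h2] := hc _ _ hp.
  split; first by rewrite /= GE /entry hi.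
  rewrite /= (_ : (fun j => _) = fun j => column (lpart beta) i j.*2.+1) //.
  by apply: funext => j; rewrite GE /entry hi.
move: hp => /onth1P[_ <-]; split; first by rewrite /= GE /entry ltnNge hi.
rewrite /= (_ : (fun j => _) = rpart (rpart beta)) //; apply: funext => j.
by rewrite GE /entry ltnNge hi -[LHS]/(rpart (join _ _) j) rpart_join.
Qed.

(** * Moduli of continuity and well-foundedness of the recursion *)

Lemma cont_nat_modulus (X : ftype) (v : C ((tnat ⇒ X) ⇒ tnat)) (f : nat -> C X) :
  exists M, forall g : nat -> C X, (forall n, n < M -> g n = f n) ->
    v (lam (X := tnat) g (cont_nat g)) = v (lam (X := tnat) f (cont_nat f)).
Proof.
have [nm hnm] := choice (@names_ex X).
(* [A g] reads one number [h] and answers with the chosen name of [g h]; as the choice is fixed,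
   functions equal at [h] get equal entries. *)
pose A (g : nat -> C X) :=
  code (fun s k => if s is h :: _ then Some (nm (g h) k) else None).
have hA g : @names (Comega (tnat ⇒ X)) (A g) (lam (X := tnat) g (cont_nat g)).
  move=> beta n /= <-; exists (nm (g (beta 0))); last exact: hnm.
  by apply: code_kapp => k; [exists 1|case=> // m y /= [<-]].
have /continuousP[V hV] := cfun_cont v.
have [e /(_ 0)[m hm]] := hV _ _ (hA f).
(* The entry of [A g] at [c] depends on [g] only through its value at [arg c]. *)
pose arg c := if (unpickle c : option (seq nat)) is Some (_ :: h :: _) then h else 0.
exists (\max_(c < m) arg c).+1 => g hg.
rewrite -[RHS]e -(hm (A g)); first by have [] := hV _ _ (hA g).
move=> c lt_c.
have := @leq_bigmax _ (fun i : 'I_m => arg i) (Ordinal lt_c).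
rewrite [nat_of_ord (Ordinal _)]/= {1}/arg /A /code.
by case: unpickle => [[|k [|h s]]|] // le_h; rewrite hg.
Qed.

Lemma oplus_wf (X : ftype) (v : C ((tnat ⇒ X) ⇒ tnat)) :
  well_founded (fun u' u : C (X^†) =>
    v (hat u) \notin dom u /\ exists x, u' = oplus u (v (hat u)) x).
Proof.
set rel := (R in well_founded R) => u0; apply: contrapT => bad0.
have /choice[next hnext] : forall u, exists u', ~ Acc rel u -> rel u' u /\ ~ Acc rel u'.
  move=> u; apply: contrapT => /forallNP h; apply: (h u) => -[].
  by constructor => u' hu'; apply: contrapT => bad'; apply: (h u').
pose u_ i := iter i next u0.
have bad i : ~ Acc rel (u_ i) by elim: i => //= i IH; case: (hnext _ IH).
have hu i : rel (u_ i.+1) (u_ i) by case: (hnext _ (bad i)).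
have mono i j n x : i <= j -> lookup (u_ i) n = Some x -> lookup (u_ j) n = Some x.
  move=> /subnKC <-; elim: (j - i) => [|k IH]; first by rewrite addn0.
  rewrite addnS => /IH; have [_ [y ->]] := hu (i + k).
  by rewrite {2}/lookup /= /oplus_fun /dom; case: eqP => //= <- ->.
(* Values once defined persist, so each place is either settled when it enters the domain or stays
   undefined forever. *)
have /choice[stage hstage] : forall n, exists i, forall j, i <= j ->
    lookup (u_ j) n = lookup (u_ i) n.
  move=> n; case: (pselect (exists i, dom (u_ i) n)) => [[i]|/forallNP hN].
    rewrite /dom; case E: lookup => [x|] // _; exists i => j /mono le_ij.
    by rewrite E; exact: le_ij.
  have hN' i : lookup (u_ i) n = None by have := hN i; rewrite /dom; case: lookup.
  by exists 0 => j _; rewrite !hN'.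
pose f n := odflt (zero X) (lookup (u_ (stage n)) n).
have [M hM] := cont_nat_modulus v f.
pose I := \max_(n < M) stage n.
have vE i : I <= i -> v (hat (u_ i)) = v (lam (X := tnat) f (cont_nat f)).
  move=> le_I; apply: hM => n lt_n; rewrite hstage //; apply: leq_trans le_I.
  exact: (@leq_bigmax _ (fun n : 'I_M => stage n) (Ordinal lt_n)).
(* From stage [I] on the query is constant; it enters the domain of [u_ I.+1], yet has to lie
   outside it. *)
have [/negP[]] := hu I.+1; rewrite vE // -(vE I) //.
have [nd [x ->]] := hu I.
by rewrite -topredE /= /dom /lookup /= /oplus_fun eqxx nd.
Qed.

Theorem theorem2p11 :
  forall X R : ftype,
  exists sBR : C ((X^† ⇒ (X ⇒ R) ⇒ R) ⇒ (X^† ⇒ R) ⇒ ((tnat ⇒ X) ⇒ tnat)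
                  ⇒ X^† ⇒ R),
  forall (phi : C (X^† ⇒ (X ⇒ R) ⇒ R)) (b : C (X^† ⇒ R))
         (vphi : C ((tnat ⇒ X) ⇒ tnat)) (u : C (X^†)),
  sBR phi b vphi u =
    if vphi (hat u) \in dom u then b u
    else phi u (lam (fun x => sBR phi b vphi (oplus u (vphi (hat u)) x))
                    (cont_ap_oplus (sBR phi b vphi) u (vphi (hat u)))).
Proof.
move=> X R.
(* The three parameters are carried along in the argument of the recursion, so that continuity in
   them comes out by currying. *)
pose P := tprod (tprod (X^† ⇒ (X ⇒ R) ⇒ R) (X^† ⇒ R)) ((tnat ⇒ X) ⇒ tnat).
pose Y := tprod P (X^†).
pose query (y : C Y) : nat := cfun_fun y.1.2 (hat y.2).
have c_query : cont Y tnat query.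
  apply: continuous_app (continuous_comp (cont_hat X) (@continuous_snd _ _)).
  exact: continuous_comp (@continuous_snd _ _) (@continuous_fst _ _).
have c_oplus : cont (tprod Y X) (X^†) (fun p => oplus p.1.2 (query p.1) p.2).
  have c_u : cont (tprod Y X) (X^†) (fun p => p.1.2).
    exact (continuous_comp (@continuous_snd (Comega P) (Comega (X^†)))
             (@continuous_fst (Comega Y) (Comega X))).
  have c_n : cont (tprod Y X) tnat (fun p => query p.1).
    exact (continuous_comp c_query (@continuous_fst (Comega Y) (Comega X))).
  exact (continuous_comp (cont_oplus_joint X) (continuous_pair c_u
           (continuous_pair c_n (@continuous_snd (Comega Y) (Comega X))))).
have [||||||f cf fE] := @bar_recursion (Comega Y) (Comega X) (Comega R)
    (fun y => dom y.2 (query y)) (fun y => cfun_fun y.1.1.2 y.2)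
    (fun p => cfun_fun (cfun_fun p.2.1.1.1 p.2.2) p.1)
    (fun p => (p.1.1, oplus p.1.2 (query p.1) p.2)).
- exact: (@names_ex Y).
- exact: continuous_comp (cont_dom X) (continuous_pair (@continuous_snd _ _) c_query).
- apply: continuous_app (@continuous_snd _ _).
  apply: continuous_comp (@continuous_snd _ _) _.
  exact: continuous_comp (@continuous_fst _ _) (@continuous_fst _ _).
- apply: continuous_app (@continuous_fst _ _).
  apply: continuous_app; last first.
    exact: continuous_comp (@continuous_snd _ _) (@continuous_snd _ _).
  apply: continuous_comp (@continuous_fst _ _) _.
  apply: continuous_comp (@continuous_fst _ _) _.
  exact: continuous_comp (@continuous_fst _ _) (@continuous_snd _ _).
- apply: continuous_pair.
    exact: continuous_comp (@continuous_fst _ _) (@continuous_fst _ _).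
  exact: c_oplus.
(* The parameters [p] never change along the recursion, so the relation reduces to that of
   [oplus_wf] for the functional [p.2]. *)
- move=> [p u]; elim/(well_founded_ind (oplus_wf p.2)): u => u IH.
  by constructor => _ [nd [x ->]]; apply: IH; split=> //; exists x.
have [F1 cF1 E1] := cont_curry cf.
have [F2 cF2 E2] := cont_curry cF1.
have [F3 cF3 E3] := cont_curry cF2.
pose sBR : C ((X^† ⇒ (X ⇒ R) ⇒ R) ⇒ (X^† ⇒ R) ⇒ ((tnat ⇒ X) ⇒ tnat) ⇒ X^† ⇒ R) :=
  CFun cF3.
have sE phi b vphi u : sBR phi b vphi u = f (phi, b, vphi, u).
  by rewrite -E1 -E2 -E3.
exists sBR => phi b vphi u; rewrite sE.
have c_rec : cont X R (fun x => f (phi, b, vphi, oplus u (vphi (hat u)) x)).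
  rewrite (_ : (fun x => _) = fun x => sBR phi b vphi (oplus u (vphi (hat u)) x)).
    exact: cont_ap_oplus.
  by apply: funext => x; rewrite sE.
rewrite (fE (_, _, _, _) c_rec); congr (if _ then _ else _).
(* The two arguments of [phi u] have the same values, and a functional is determined by its values
   whatever its proof of continuity. *)
by apply: (congr1 (ap (phi u))); apply: cfun_ext => x; rewrite /= -sE.
Qed.
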